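(* Let $\mu$ be a probability measure on $\mathcal{X}$ and let $S$ be a class of classifiers on $\mathcal{X}$ satisfying the separability condition (M) and such that, for some constant $K_1>0$ and some positive number $r<1$, $$H_{[\cdot]}(\varepsilon,S,\mu)\le K_1\varepsilon^{-r}\qquad\text{for every }\varepsilon\in(0,1).$$ Let $h\in[0,1]$ and let $\hat s$ be an empirical risk minimizer over $S$. Then, for some constant $C_1$ depending only on $K_1$ and $r$, $$\sup_{P\in\mathcal{P}(h,S,\mu)}\mathbb{E}[\ell(s^*,\hat s)]\le C_1\left((nh^{1-r})^{-1/(r+1)}\wedge n^{-1/2}\right).$$
   Context: Binary classification setting: one observes $n$ independent copies $(X_1,Y_1),\dots,(X_n,Y_n)$ of a pair $(X,Y)$ with distribution $P$ on $\mathcal{X}\times\{0,1\}$, $\mathcal{X}$ a measurable space. A classifier is a measurable map $t:\mathcal{X}\to\{0,1\}$; $\eta(x)=P[Y=1\mid X=x]$ is the regression function, $s^*(x)=\mathbb{1}_{\eta(x)\ge1/2}$ is the Bayes classifier (both depend on $P$), and $\ell(s^*,t)=P(Y\ne t(X))-P(Y\ne s^*(X))$. $\mathcal{P}(h,S,\mu)$ is the set of probability distributions $P$ on $\mathcal{X}\times\{0,1\}$ whose first marginal is $\mu$ and such that $|2\eta(x)-1|\ge h$ for all $x\in\mathcal{X}$ and $s^*\in S$. An empirical risk minimizer over $S$ is an estimator (measurable function of the sample) with values in $S$ which minimizes $\gamma_n(t)=n^{-1}\sum_{i=1}^n\mathbb{1}_{Y_i\ne t(X_i)}$ over $t\in S$.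 Entropy with bracketing: $H_{[\cdot]}(\varepsilon,S,\mu)$ is the logarithm of the minimal number of brackets $[f,g]=\{t: f\le t\le g\}$ with $\|f-g\|_1\le\varepsilon$ which are necessary to cover $S$, where $\|\cdot\|_1$ is the $\mathbb{L}_1(\mu)$-norm. Condition (M): there exists a countable subset $S'$ of $S$ such that, for every $t\in S$, there is a sequence $(t_k)$ in $S'$ such that, for every $(x,y)\in\mathcal{X}\times\{0,1\}$, $\mathbb{1}_{y\ne t_k(x)}\to\mathbb{1}_{y\ne t(x)}$ as $k\to\infty$. $a\wedge b=\min(a,b)$; for $h=0$ the term $(nh^{1-r})^{-1/(r+1)}$ is read as $+\infty$. *)

(* Defs.v *)
From HB Require Import structures.
From mathcomp Require Import all_boot all_order all_algebra.
From mathcomp Require Import all_classical all_reals all_analysis.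
From mathcomp Require Import measurable_realfun.
Set Implicit Arguments.
Unset Strict Implicit.
Unset Printing Implicit Defensive.
Import Order.TTheory GRing.Theory Num.Theory.
Import numFieldNormedType.Exports.
Local Open Scope classical_set_scope.
Local Open Scope ring_scope.

Section iid_sample.
Context {d : measure_display} {T : measurableType d} {R : realType}.

Definition tuple_cons (n : nat) (x : T * n.-tuple T) : n.+1.-tuple T :=
  [the n.+1.-tuple T of x.1 :: x.2].

Let measurable_tuple_cons n : measurable_fun setT (@tuple_cons n).
Proof. exact: measurable_cons. Qed.

HB.instance Definition _ n :=
  isMeasurableFun.Build _ _ _ _ (@tuple_cons n) (@measurable_tuple_cons n).

(* The n-fold product of P, built coordinate by coordinate; the characteristic
   identity on boxes is iid_law_box below. *)
Fixpoint iid_law (P : probability T R) (n : nat) :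
    probability (n.-tuple T) R :=
  match n with
  | 0%N => \d_ [tuple]
  | m.+1 => distribution (P \x iid_law P m)%E (@tuple_cons m)
  end.

Lemma iid_law_box (P : probability T R) (n : nat) (A : 'I_n -> set T) :
  (forall i, measurable (A i)) ->
  iid_law P n [set z | forall i, A i (tnth z i)] = (\prod_(i < n) P (A i))%E.
Proof.
elim: n A => [A _|n ih A mA].
  rewrite big_ord0 /= diracE mem_set//= => -[]//.
rewrite big_ord_recl /= /distribution /pushforward.
rewrite -ih; last by move=> i; exact: mA.
pose B := [set z : n.-tuple T | forall i, A (lift ord0 i) (tnth z i)].
rewrite (_ : _ @^-1` _ = A ord0 `*` B); last first.
  apply/seteqP; split=> -[x z] /=.
    move=> h; split; first by have := h ord0.
    by move=> i; have := h (lift ord0 i); rewrite tnthS.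
  move=> [hx hz] i; have [j ->|->] := unliftP ord0 i; last by [].
  by rewrite tnthS; exact: hz.
rewrite -/B.
have mB : measurable B.
  rewrite (_ : B = \bigcap_(i in [set: 'I_n])
      ((@tnth _ T ^~ i) @^-1` A (lift ord0 i))).
    apply: fin_bigcap_measurable => // i _.
    by rewrite -[X in measurable X]setTI; exact: measurable_tnth.
  by apply/seteqP; split=> z h i; [move=> _; exact: h|exact: (h i I)].
exact: product_measure1E.
Qed.

End iid_sample.

Section classification.
Context {d : measure_display} {X : measurableType d} {R : realType}.

(* Labels are booleans, true standing for 1. *)
Definition classifier (t : X -> bool) : Prop := measurable_fun setT t.

(* eta is a version of x |-> P[Y = 1 | X = x], where mu is the law of X. *)
Definition regression_function (mu : probability X R)
    (P : probability (X * bool)%type R) (eta : X -> R) : Prop :=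
  [/\ measurable_fun setT eta,
      forall x, 0 <= eta x <= 1 &
      forall A : set X, measurable A ->
        P (A `*` [set true]) = (\int[mu]_(x in A) (eta x)%:E)%E].

Definition bayes (eta : X -> R) : X -> bool := fun x => 2^-1 <= eta x.

(* The margin condition and the condition on the Bayes classifier hold at every
   point, so they concern a version of the regression function and not only P:
   the elements of the model are the laws together with such a version. *)
Definition margin_model (h : R) (S : set (X -> bool)) (mu : probability X R) :
    set (probability (X * bool)%type R * (X -> R)) :=
  [set Q : probability (X * bool)%type R * (X -> R) |
    [/\ forall A : set X, measurable A -> Q.1 (A `*` setT) = mu A,
        regression_function mu Q.1 Q.2,
        forall x, h <= `|2 * Q.2 x - 1| &
        S (bayes Q.2)]].

Definition risk (P : probability (X * bool)%type R) (t : X -> bool) : R :=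
  fine (P [set z | z.2 != t z.1]).

Definition excess_risk (P : probability (X * bool)%type R)
    (s t : X -> bool) : R :=
  risk P t - risk P s.

Definition empirical_risk (n : nat) (z : n.-tuple (X * bool)%type)
    (t : X -> bool) : R :=
  n%:R^-1 * \sum_(i < n) ((tnth z i).2 != t (tnth z i).1)%:R.

(* Measurability of an estimator valued in classifiers: measurability for the
   sigma-algebra generated by the balls of the L1(mu) pseudometric.  It makes
   the excess risk a measurable function of the sample, and holds as soon as
   (z, x) |-> shat z x is measurable. *)
Definition estimator (mu : probability X R) (n : nat)
    (shat : n.-tuple (X * bool)%type -> X -> bool) : Prop :=
  (forall z, classifier (shat z)) /\
  (forall t, classifier t ->
     measurable_fun setT (fun z => mu [set x | shat z x != t x])).

Definition empirical_risk_minimizer (mu : probability X R)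
    (S : set (X -> bool)) (n : nat)
    (shat : n.-tuple (X * bool)%type -> X -> bool) : Prop :=
  [/\ estimator mu shat,
      forall z, S (shat z) &
      forall z t, S t -> empirical_risk z (shat z) <= empirical_risk z t].

Definition bracket_cover (eps : R) (S : set (X -> bool))
    (mu : probability X R) (N : nat) : Prop :=
  exists f g : 'I_N -> X -> R,
    (forall i, [/\ measurable_fun setT (f i), measurable_fun setT (g i) &
       ('N[mu]_1[(fun x => (f i x - g i x)%:E)] <= eps%:E)%E]) /\
    (forall t, S t -> exists i, forall x, f i x <= (t x)%:R <= g i x).

(* +oo when no finite family of brackets covers S. *)
Definition bracketing_number (eps : R) (S : set (X -> bool))
    (mu : probability X R) : \bar R :=
  ereal_inf [set (N%:R)%:E | N in bracket_cover eps S mu].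

Definition bracketing_entropy (eps : R) (S : set (X -> bool))
    (mu : probability X R) : \bar R :=
  lne (bracketing_number eps S mu).

Definition condition_M (S : set (X -> bool)) : Prop :=
  exists S' : set (X -> bool),
    [/\ countable S', S' `<=` S &
        forall t, S t -> exists u : nat -> X -> bool,
          (forall k, S' (u k)) /\
          (forall (x : X) (y : bool),
             ((y != u k x)%:R : R) @[k --> \oo] --> ((y != t x)%:R : R))].

Definition expected_excess_risk (P : probability (X * bool)%type R)
    (eta : X -> R) (n : nat) (shat : n.-tuple (X * bool)%type -> X -> bool) :
    \bar R :=
  ('E_(iid_law P n) [(fun z => excess_risk P (bayes eta) (shat z))])%E.

End classification.

Arguments condition_M {d X} R S.

(* (n h^(1-r))^(-1/(r+1)), with value +oo at h = 0. *)
Definition margin_rate {R : realType} (n : nat) (h r : R) : \bar R :=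
  if h == 0 then +oo%E
  else ((n%:R * h `^ (1 - r)) `^ (- (r + 1)^-1))%:E.

(* Main.v *)
Require Import Defs.
From mathcomp Require Import all_boot all_order all_algebra.
From mathcomp Require Import all_classical all_reals all_analysis.
From mathcomp Require Import measurable_realfun.
From mathcomp Require Import ring lra.
Set Implicit Arguments.
Unset Strict Implicit.
Unset Printing Implicit Defensive.
Import Order.TTheory GRing.Theory Num.Theory.
Import numFieldNormedType.Exports.
Local Open Scope classical_set_scope.
Local Open Scope ring_scope.

(* Write l for the excess risk of the empirical risk minimizer. Since l is at
   most a difference of deviations between the true and the empirical risk, it
   is decomposed along a chain of lower brackets of sizes delta_k = delta_0 / 2^k.
   At each level the deviation between two brackets exceeds 2 theta_k times
   their distance by at most (log N + G) / (n theta_k), uniformly over the N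
   pairs of brackets, where E G <= 1 (exponential moments). This penalized form
   makes localization automatic: at level 0 the distance to the Bayes
   classifier is at most delta_0 + l / h, so theta_0 = h / 4 produces a term l / 2
   that is absorbed by the left-hand side, without peeling or concentration.
   With delta_0 = e / (2 h), where e = (n h^(1-r))^(-1/(r+1)), all terms are of
   order e; the chain stops at delta = n^(-1/(r+1)), before the Poissonian part
   of Bernstein's bound takes over. The bound n^(-1/2) is the case where h is
   replaced by max(h, n^(-1/2)). *)

(** * Elementary bounds on exponentials and powers *)

Section real_inequalities.
Context {R : realType}.
Implicit Types u : R.

(** From $e^u \ge 1+u$ and $(1+u)(1-u+u^2) = 1+u^3 \ge 1$. *)
Lemma expRN_le_quadratic u : 0 <= u -> expR (- u) <= 1 - u + u ^+ 2.
Proof.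
move=> u0; have := expR_ge1Dx u; rewrite expRN => h.
rewrite invf_ple ?posrE ?expR_gt0//; last by nra.
apply: le_trans h; rewrite -[leLHS]mul1r ler_pdivrMr; last by nra.
have : 0 <= u ^+ 3 by rewrite exprn_ge0.
by rewrite !exprS expr0; nra.
Qed.

(** From $e^{-u} \ge 1-u$ and $(1-u)(1+u+2u^2) = 1+u^2(1-2u)$; this is where $u \le 1/2$ enters. *)
Lemma expR_le_quadratic u : 0 <= u <= 2^-1 -> expR u <= 1 + u + 2 * u ^+ 2.
Proof.
move=> /andP[u0 u1]; have := expR_ge1Dx (- u).
rewrite expRN => h; rewrite -[expR u]invrK.
rewrite invf_ple ?posrE ?invr_gt0 ?expR_gt0//; last by nra.
apply: le_trans h; rewrite -[leLHS]mul1r ler_pdivrMr; last by nra.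
have : 0 <= u ^+ 2 * (1 - 2 * u) by rewrite mulr_ge0// ?exprn_ge0//; lra.
by rewrite !exprS expr0; nra.
Qed.

Lemma powRN_ge1 (x r : R) : 0 < x <= 1 -> 0 <= r -> 1 <= x `^ (- r).
Proof.
move=> /[dup] x01 /andP[x0 x1] r0.
by rewrite -(powRr0 x); apply: (ger_powR x01); rewrite oppr_le0.
Qed.

End real_inequalities.

(** * Monotonicity of the integral, and independence *)

Section integrals.
Context {d : measure_display} {T : measurableType d} {R : realType}.

(** The comparison is made on the suprema over simple functions: those below [f] also lie below
    [g]. *)
Lemma ge0_le_integralT (mu : {measure set T -> \bar R}) (f g : T -> \bar R) :
  (forall x, 0 <= f x)%E -> (forall x, f x <= g x)%E ->
  (\int[mu]_x f x <= \int[mu]_x g x)%E.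
Proof.
move=> f0 fg; have g0 x : (0 <= g x)%E by exact: le_trans (fg x).
rewrite !ge0_integralTE//; apply: ge_ereal_sup => _ [h /= hf <-].
by apply: ereal_sup_ubound; exists h => //= x; exact: le_trans (fg x).
Qed.

(** Independence in product form, peeling off the first coordinate with Tonelli. It turns the
    exponential moment of a sum over the sample into a power. *)
Lemma integral_iid_law_prod (P : probability T R) (n : nat) (phi : T -> R) :
  measurable_fun setT phi -> (forall x, 0 <= phi x) ->
  (\int[iid_law P n]_z (\prod_(i < n) phi (tnth z i))%:E
   = (\int[P]_x (phi x)%:E) ^+ n)%E.
Proof.
move=> mphi phi0.
have mprod m : measurable_fun setT
    (fun z : m.-tuple T => \prod_(i < m) phi (tnth z i)).
  apply: measurable_prod => i _.
  by apply: measurableT_comp => //; exact: measurable_tnth.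
have prod0 m (z : m.-tuple T) : 0 <= \prod_(i < m) phi (tnth z i).
  by rewrite prodr_ge0.
elim: n => [|n ih].
  under eq_integral do rewrite big_ord0.
  by rewrite integral_cst// mul1e expe0; exact: probability_setT.
rewrite expeS /= ge0_integral_pushforward//=; last 2 first.
- by apply/measurable_EFinP; exact: (mprod n.+1).
- by move=> z _; rewrite lee_fin; exact: (prod0 n.+1).
rewrite preimage_setT fubini_tonelli1/=; last 2 first.
- apply/measurable_EFinP; apply: (measurableT_comp (mprod n.+1)).
  exact: measurable_funP.
- by move=> z; rewrite lee_fin; exact: (prod0 n.+1).
under eq_integral => x _.
  rewrite /fubini_F.
  under eq_integral => z _.
    rewrite big_ord_recl EFinM.
    rewrite (_ : tnth _ ord0 = x)//.
    under eq_bigr do rewrite tnthS.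
    over.
  rewrite ge0_integralZl_EFin//; last 2 first.
  - by move=> z _; rewrite lee_fin; exact: (prod0 n).
  - by apply/measurable_EFinP; exact: (mprod n).
  rewrite /= ih.
  over.
rewrite ge0_integralZr//.
- exact/measurable_EFinP.
- by move=> x _; rewrite lee_fin.
- by rewrite expe_ge0// integral_ge0// => x _; rewrite lee_fin.
Qed.

End integrals.

(** * Exponential moments and penalized deviations over finite classes *)

Section deviations.
Context {d : measure_display} {T : measurableType d} {R : realType}.
Variable P : probability T R.
Implicit Types D : set T.

Definition pr D : R := fine (P D).

(** The measure of the symmetric difference, that is the $L^1(P)$ distance of the indicators. It is
    also the second moment of their difference, hence its role as a variance term. *)
Definition pdist D D' : R := pr (D `\` D') + pr (D' `\` D).

Definition empirical {n : nat} (z : n.-tuple T) D : R :=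
  n%:R^-1 * \sum_(i < n) \1_D (tnth z i).

Definition deviation {n : nat} (z : n.-tuple T) D : R := pr D - empirical z D.

Lemma prE D : measurable D -> P D = (pr D)%:E.
Proof. by move=> mD; rewrite fineK// fin_num_measure. Qed.

Lemma pr_ge0 D : 0 <= pr D.
Proof. exact: fine_ge0. Qed.

Lemma le_pr D D' : measurable D -> measurable D' -> D `<=` D' -> pr D <= pr D'.
Proof.
by move=> mD mD' DD'; rewrite -lee_fin -!prE// le_measure// inE.
Qed.

Lemma pr_le1 D : measurable D -> pr D <= 1.
Proof. by move=> mD; rewrite -lee_fin -prE// probability_le1. Qed.

Lemma prU D D' : measurable D -> measurable D' -> [disjoint D & D'] ->
  pr (D `|` D') = pr D + pr D'.
Proof.
move=> mD mD' /disj_setPS DD'; apply: EFin_inj.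
rewrite EFinD -!prE//; last exact: measurableU.
by rewrite measureU//; apply/seteqP; split.
Qed.

Lemma prB D D' : measurable D -> measurable D' ->
  pr D - pr D' = pr (D `\` D') - pr (D' `\` D).
Proof.
move=> mD mD'.
have split_pr E E' : measurable E -> measurable E' ->
    pr E = pr (E `\` E') + pr (E `&` E').
  move=> mE mE'; rewrite -prU//; [|exact: measurableD|exact: measurableI|].
    by congr pr; rewrite setDE -setIUr setUC setUv setIT.
  by apply/disj_setPS => x [[_ h] [_ h']].
by rewrite (split_pr D D')// (split_pr D' D)// setIC; ring.
Qed.

Lemma le_prU D D' : measurable D -> measurable D' ->
  pr (D `|` D') <= pr D + pr D'.
Proof.
move=> mD mD'; rewrite -lee_fin EFinD -!prE//; last exact: measurableU.
exact: measureU2.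
Qed.

Lemma pdistC D D' : pdist D D' = pdist D' D.
Proof. by rewrite /pdist addrC. Qed.

Lemma pdist_triangle D D' D'' :
  measurable D -> measurable D' -> measurable D'' ->
  pdist D D'' <= pdist D D' + pdist D' D''.
Proof.
have half A B C : measurable A -> measurable B -> measurable C ->
    pr (A `\` C) <= pr (A `\` B) + pr (B `\` C).
  move=> mA mB mC; apply: le_trans (le_prU _ _); try exact: measurableD.
  apply: le_pr.
  - exact: measurableD.
  - by apply: measurableU; exact: measurableD.
  - by move=> x [Ax nCx]; have [Bx|nBx] := pselect (B x); [right|left].
move=> mD mD' mD''; rewrite /pdist.
by have := half _ _ _ mD mD' mD''; have := half _ _ _ mD'' mD' mD; lra.
Qed.

(** A Bernstein bound for one observation. Pointwise, by cases on membership in [D] and [D'], the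
    exponent is $0$ or $\pm\theta$ and the quadratic bounds apply; integrating gives at most $1-c$,
    and $1-c \le e^{-c}$ concludes. *)
Lemma mgf_indic_diff (th : R) D D' : measurable D -> measurable D' ->
  0 <= th <= 2^-1 ->
  (\int[P]_x (expR (th * (pr D - pr D' - (\1_D x - \1_D' x))
                    - 2 * th ^+ 2 * pdist D D'))%:E <= 1)%E.
Proof.
move=> mD mD' /andP[th0 th1].
have mI A : measurable A -> measurable_fun setT (\1_A : T -> R).
  by move=> mA; exact: measurable_indic.
have intI A : measurable A -> (\int[P]_x (\1_A x)%:E = (pr A)%:E)%E.
  by move=> mA; rewrite integral_indic// setIT; exact: prE.
pose e x : R := expR (- (th * (\1_D x - \1_D' x))).
have me : measurable_fun setT e.
  apply: measurableT_comp => //; apply: measurableT_comp => //.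
  by apply: measurable_funM => //; apply: measurable_funB; exact: mI.
pose c := th * (pr D - pr D') - 2 * th ^+ 2 * pdist D D'.
(* The term in [pr D] stands on the left so that both sides are integrals of nonnegative
   functions. *)
have key : (\int[P]_x (e x)%:E + (th * pr D)%:E <=
    (1 + th * pr D' + 2 * th ^+ 2 * pdist D D')%:E)%E.
  pose f x : R := th * \1_D' x + 2 * th ^+ 2 * (\1_(D `\` D') x + \1_(D' `\` D) x).
  have mDD := measurableD mD mD'; have mDD' := measurableD mD' mD.
  have le x : e x + th * \1_D x <= 1 + f x.
    have l1 := expRN_le_quadratic th0.
    have l2 : expR th <= 1 + th + 2 * th ^+ 2.
      by apply: expR_le_quadratic; rewrite th0.
    rewrite /e /f !indicE !in_setD.
    case: (x \in D); case: (x \in D') => /=;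
      rewrite ?(oppr0, addr0, subrr, mulr0, expR0, mulr1, sub0r, mulrN1, opprK);
      by have := sqr_ge0 th; nra.
  have f0 x : 0 <= f x.
    by rewrite /f addr_ge0// mulr_ge0// ?addr_ge0// mulr_ge0// exprn_ge0.
  have mf : measurable_fun setT f.
    apply: measurable_funD.
      by apply: measurable_funM => //; exact: mI.
    apply: measurable_funM => //.
    by apply: measurable_funD; exact: mI.
  have -> : (\int[P]_x (e x)%:E + (th * pr D)%:E =
      \int[P]_x (e x + th * \1_D x)%:E)%E.
    under [RHS]eq_integral do rewrite EFinD.
    rewrite ge0_integralD//; last 4 first.
    - by move=> x _; rewrite lee_fin expR_ge0.
    - exact/measurable_EFinP.
    - by move=> x _; rewrite lee_fin mulr_ge0.
    - apply/measurable_EFinP; apply: measurable_funM => //; exact: mI.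
    congr (_ + _)%E.
    under [RHS]eq_integral do rewrite EFinM.
    rewrite ge0_integralZl_EFin// ?intI//.
    by apply/measurable_EFinP; exact: mI.
  have -> : (1 + th * pr D' + 2 * th ^+ 2 * pdist D D')%:E =
      (\int[P]_x (1 + f x)%:E)%E.
    under [RHS]eq_integral do rewrite EFinD.
    rewrite ge0_integralD//; last 2 first.
    - by move=> x _; rewrite lee_fin.
    - exact/measurable_EFinP.
    rewrite integral_cst// -addrA EFinD.
    congr (_ + _)%E; first by rewrite mul1e; exact/esym/probability_setT.
    under [RHS]eq_integral do rewrite EFinD.
    rewrite ge0_integralD//; last 4 first.
    - by move=> x _; rewrite lee_fin mulr_ge0.
    - apply/measurable_EFinP; apply: measurable_funM => //; exact: mI.
    - by move=> x _; rewrite lee_fin mulr_ge0// ?addr_ge0// mulr_ge0// exprn_ge0.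
    - apply/measurable_EFinP; apply: measurable_funM => //.
      by apply: measurable_funD; exact: mI.
    rewrite EFinD; congr (_ + _)%E.
      under [RHS]eq_integral do rewrite EFinM.
      rewrite ge0_integralZl_EFin// ?intI//.
      by apply/measurable_EFinP; exact: mI.
    under [RHS]eq_integral do rewrite EFinM EFinD.
    rewrite ge0_integralZl_EFin//; last 3 first.
    - by move=> x _; rewrite -EFinD lee_fin addr_ge0.
    - by apply: emeasurable_funD; apply/measurable_EFinP; exact: mI.
    - by rewrite mulr_ge0// exprn_ge0.
    rewrite ge0_integralD//; last 2 first.
    - by apply/measurable_EFinP; exact: mI.
    - by apply/measurable_EFinP; exact: mI.
    by rewrite !intI// EFinM.
  by apply: ge0_le_integralT => x; rewrite lee_fin ?addr_ge0 ?expR_ge0 ?mulr_ge0.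
have : (\int[P]_x (e x)%:E <= (1 - c)%:E)%E.
  have -> : 1 - c = 1 + th * pr D' + 2 * th ^+ 2 * pdist D D' - th * pr D.
    by rewrite /c; ring.
  by rewrite EFinB leeBrDr.
have -> : (\int[P]_x (expR (th * (pr D - pr D' - (\1_D x - \1_D' x))
                    - 2 * th ^+ 2 * pdist D D'))%:E =
   (expR c)%:E * \int[P]_x (e x)%:E)%E.
  rewrite -ge0_integralZl_EFin//; last 2 first.
  - by move=> x _; rewrite lee_fin expR_ge0.
  - exact/measurable_EFinP.
  apply: eq_integral => x _; rewrite -EFinM /e -expRD; congr (expR _)%:E.
  by rewrite /c; ring.
move=> h; apply: (@le_trans _ _ ((expR c)%:E * (expR (- c))%:E)%E).
  apply: lee_pmul => //; rewrite ?lee_fin ?expR_ge0//.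
    by apply: integral_ge0 => x _; rewrite lee_fin expR_ge0.
  by apply: le_trans h _; rewrite lee_fin; exact: expR_ge1Dx.
by rewrite -EFinM -expRD subrr expR0.
Qed.

(** A union bound in expectation. [G] is the average over [i] of the exponentials [F i], each of
    mean at most 1. Since [F i z / #|I|] is at most [G z], and $u \le e^u - 1$, the logarithm of
    [F i z] is at most $\ln|I| + G(z)$. *)
Lemma finite_class_deviation (I : finType) (D D' : I -> set T) (n : nat)
    (th : R) :
  (0 < #|I|)%N -> (0 < n)%N -> 0 < th <= 2^-1 ->
  (forall i, measurable (D i)) -> (forall i, measurable (D' i)) ->
  exists G : n.-tuple T -> R,
    [/\ measurable_fun setT G, forall z, 0 <= G z,
        (\int[iid_law P n]_z (G z)%:E <= 1)%E &
        forall z i, deviation z (D i) - deviation z (D' i) <=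
          2 * th * pdist (D i) (D' i) + (ln #|I|%:R + G z) / (n%:R * th)].
Proof.
move=> I0 n0 /andP[th0 th1] mD mD'.
have N0 : 0 < #|I|%:R :> R by rewrite ltr0n.
have n0' : 0 < n%:R :> R by rewrite ltr0n.
pose phi i x := expR (th * (pr (D i) - pr (D' i) - (\1_(D i) x - \1_(D' i) x))
                    - 2 * th ^+ 2 * pdist (D i) (D' i)).
have phi0 i x : 0 <= phi i x by exact: expR_ge0.
have mphi i : measurable_fun setT (phi i).
  apply: measurableT_comp => //; apply: measurable_funB => //.
  apply: measurable_funM => //; apply: measurable_funB => //.
  by apply: measurable_funB; exact: measurable_indic.
pose F i (z : n.-tuple T) := \prod_(j < n) phi i (tnth z j).
have F0 i z : 0 <= F i z by rewrite prodr_ge0.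
have mF i : measurable_fun setT (F i).
  apply: measurable_prod => j _.
  by apply: measurableT_comp => //; exact: measurable_tnth.
have FE i z : F i z = expR (n%:R * th * (deviation z (D i) - deviation z (D' i)
    - 2 * th * pdist (D i) (D' i))).
  rewrite /F /phi -expR_sum; congr expR.
  rewrite sumrB sumr_const card_ord -mulr_sumr sumrB sumr_const card_ord sumrB.
  rewrite /deviation /empirical -[_ *+ n]mulr_natr -[X in _ - X]mulr_natr.
  by field; rewrite gt_eqF.
have intF i : (\int[iid_law P n]_z (F i z)%:E <= 1)%E.
  rewrite integral_iid_law_prod//.
  have i0 : (0 <= \int[P]_x (phi i x)%:E)%E.
    by apply: integral_ge0 => x _; rewrite lee_fin.
  have i1 : (\int[P]_x (phi i x)%:E <= 1)%E.
    by apply: mgf_indic_diff => //; rewrite (ltW th0).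
  elim: (n) => [|m ih]; first by rewrite expe0.
  by rewrite expeS -[leRHS]mule1 lee_pmul// expe_ge0.
exists (fun z => #|I|%:R^-1 * \sum_i F i z); split.
- by apply: measurable_funM => //; apply: measurable_sum => i.
- by move=> z; rewrite mulr_ge0 ?invr_ge0// sumr_ge0.
- under eq_integral do rewrite EFinM -sumEFin.
  rewrite ge0_integralZl_EFin//; last 2 first.
  + by move=> z _; rewrite sume_ge0// => i _; rewrite lee_fin.
  + by apply: emeasurable_sum => i; apply/measurable_EFinP.
  rewrite ge0_integral_sum//; last 2 first.
  + by move=> i; apply/measurable_EFinP.
  + by move=> i z _; rewrite lee_fin.
  apply: (@le_trans _ _ (#|I|%:R^-1%:E * \sum_(i : I) 1)%E).
    apply: lee_pmul => //; rewrite ?lee_fin ?invr_ge0//.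
      by apply: sume_ge0 => i _; apply: integral_ge0 => z _; rewrite lee_fin.
    exact: lee_sum.
  rewrite sumEFin -EFinM sumr_const lee_fin.
  by rewrite mulVf// gt_eqF.
- move=> z i; set G := _ * \sum_i _.
  have h : F i z / #|I|%:R <= G.
    rewrite /G mulrC ler_pM2l ?invr_gt0//.
    by rewrite (bigD1 i)//= lerDl sumr_ge0.
  rewrite -lerBlDl ler_pdivlMr ?mulr_gt0// -lerBlDl.
  apply: le_trans h; rewrite FE -[X in _ / X]lnK ?posrE// -expRN -expRD.
  rewrite (mulrC _ (n%:R * th)).
  set u := _ - ln _; have := expR_ge1Dx u; rewrite -/u; lra.
Qed.

End deviations.

(** * Error sets of classifiers and of brackets *)

Section loss_sets.
Context {d : measure_display} {X : measurableType d} {R : realType}.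
Implicit Types (A B : set X) (s t : X -> bool).

Definition loss_set t : set (X * bool)%type := [set z | z.2 != t z.1].

(* The set where every classifier of the bracket [1_A, 1_B] errs. *)
Definition bracket_loss A B : set (X * bool)%type :=
  (~` B) `*` [set true] `|` A `*` [set false].

Lemma measurable_loss_set t : classifier t -> measurable (loss_set t).
Proof.
move=> mt; have mp b : measurable (t @^-1` [set b]).
  by rewrite -[X in measurable X]setTI; exact: mt.
rewrite (_ : loss_set t = t @^-1` [set false] `*` [set true] `|`
                          t @^-1` [set true] `*` [set false]).
  by apply: measurableU; exact: measurableX.
by apply/seteqP; split=> -[x b]; rewrite /loss_set /=;
  case: b; case: (t x) => //=; intuition.
Qed.

Lemma measurable_bracket_loss A B : measurable A -> measurable B ->
  measurable (bracket_loss A B).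
Proof.
by move=> mA mB; apply: measurableU; apply: measurableX => //;
  exact: measurableC.
Qed.

Lemma measurable_neq s t : classifier s -> classifier t ->
  measurable [set x | t x != s x].
Proof.
move=> ms mt; rewrite (_ : [set _ | _] = (fun x => t x (+) s x) @^-1` [set true]).
  rewrite -[X in measurable X]setTI.
  rewrite (_ : (fun x => _) = (fun x => (t x && ~~ s x) || (~~ t x && s x))).
    apply: measurable_or => //; apply: measurable_and => //;
    exact: measurable_neg.
  by apply/funext => x; case: (t x); case: (s x).
by apply/seteqP; split => x /=; case: (t x); case: (s x).
Qed.

Lemma bracket_loss_sub A B t : A `<=` t -> t `<=` B ->
  bracket_loss A B `<=` loss_set t.
Proof.
move=> At tB [x b]; rewrite /bracket_loss /loss_set /= => -[[nB ->]|[/At tx ->]].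
  by apply/negP => /eqP tx; apply: nB; apply: tB; rewrite /= -tx.
by have -> : t x = true by exact: tx.
Qed.

(** Outside [B \ A] the bracket fixes the value of [t], so an error of [t] there is an error of
    every classifier of the bracket. *)
Lemma loss_set_sub_bracket A B t : A `<=` t -> t `<=` B ->
  loss_set t `\` bracket_loss A B `<=` (B `\` A) `*` setT.
Proof.
move=> At tB [x b]; rewrite /bracket_loss /loss_set /= => -[tb nl].
split=> //; split; apply: contrapT => h; apply: nl.
  left; split=> //; case: b tb => //; case E : (t x) => // _.
  by exfalso; apply: h; apply: tB.
right; have tx : t x = true by apply: At; exact: contrapT.
by split; [exact: contrapT|move: tb; rewrite tx; case: b].
Qed.

End loss_sets.

(** * Excess risk, distances and the margin condition *)

Section margin.
Context {d : measure_display} {X : measurableType d} {R : realType}.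
Variables (mu : probability X R) (P : probability (X * bool)%type R).
Hypothesis marginal : forall A, measurable A -> P (A `*` setT) = mu A.
Implicit Types (A B : set X) (s t : X -> bool).

Lemma empirical_loss_set n (z : n.-tuple (X * bool)%type) t :
  empirical z (loss_set t) = empirical_risk z t :> R.
Proof.
congr (_ * _); apply: eq_bigr => i _; rewrite indicE.
by rewrite mem_setE.
Qed.

Lemma pr_marginal A : measurable A -> pr P (A `*` setT) = pr mu A.
Proof. by move=> mA; rewrite /pr marginal. Qed.

Lemma pdist_loss_set s t : classifier s -> classifier t ->
  pdist P (loss_set t) (loss_set s) <= pr mu [set x | t x != s x].
Proof.
move=> ms mt; have [mls mlt] := (measurable_loss_set ms, measurable_loss_set mt).
rewrite /pdist -prU//; [|exact: measurableD|exact: measurableD|]; last first.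
  by apply/disj_setPS => x [[h _] [_ h']].
have mn := measurable_neq ms mt.
rewrite -pr_marginal//; apply: le_pr; first by apply: measurableU; exact: measurableD.
  exact: measurableX.
by move=> [x b] /=; rewrite /loss_set /=; case: b; case: (t x); case: (s x); intuition.
Qed.

(** One half of the symmetric difference is empty, the other projects into [B \ A]. *)
Lemma pdist_bracket_loss A B t : measurable A -> measurable B -> classifier t ->
  A `<=` t -> t `<=` B ->
  pdist P (loss_set t) (bracket_loss A B) <= pr mu (B `\` A).
Proof.
move=> mA mB mt At tB; have mlt := measurable_loss_set mt.
have ml := measurable_bracket_loss mA mB; have mBA := measurableD mB mA.
rewrite /pdist [X in _ + pr P X](_ : _ = set0).
  rewrite {2}/pr measure0 addr0 -pr_marginal//; apply: le_pr.
  - exact: measurableD.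
  - exact: measurableX.
  - exact: loss_set_sub_bracket.
by apply/seteqP; split => // x [/(bracket_loss_sub At tB)].
Qed.

(** Shrinking the error set to that of the bracket can only lower the empirical risk, and lowers the
    true risk by at most the size of the bracket. The end of the chain thus needs no further
    deviation bound. *)
Lemma deviation_bracket_loss n (z : n.-tuple (X * bool)%type) A B t :
  measurable A -> measurable B -> classifier t -> A `<=` t -> t `<=` B ->
  deviation P z (loss_set t) <=
  deviation P z (bracket_loss A B) + pr mu (B `\` A).
Proof.
move=> mA mB mt At tB; have mlt := measurable_loss_set mt.
have ml := measurable_bracket_loss mA mB.
rewrite /deviation.
have : empirical z (bracket_loss A B) <= empirical z (loss_set t) :> R.
  rewrite ler_wpM2l ?invr_ge0// ler_sum// => i _; rewrite !indicE ler_nat.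
  case: (boolP (_ \in bracket_loss A B)) => //.
  by rewrite inE => /(bracket_loss_sub At tB) tz; rewrite mem_set.
have := pdist_bracket_loss mA mB mt At tB; have := prB P mlt ml.
by rewrite /pdist; have := pr_ge0 P (bracket_loss A B `\` loss_set t); lra.
Qed.

Lemma margin_le_excess_risk (eta : X -> R) (h : R) t :
  regression_function mu P eta -> (forall x, h <= `|2 * eta x - 1|) ->
  classifier (bayes eta) -> classifier t ->
  h * pr mu [set x | t x != bayes eta x] <= excess_risk P (bayes eta) t.
Proof.
move=> [meta eta01 etaP] margin ms mt; set s := bayes eta.
have [mls mlt] := (measurable_loss_set ms, measurable_loss_set mt).
rewrite /excess_risk /risk -/(loss_set t) -/(loss_set s) -/(pr P _) -/(pr P _).
rewrite prB//.
(* The disagreement set splits according to the value of [s]: the margin gives $\eta \le (1-h)/2$ on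
   [D1] and $\eta \ge (1+h)/2$ on [D2], so each point contributes at least $h$. *)
pose D1 := [set x | t x && ~~ s x]; pose D2 := [set x | ~~ t x && s x].
have mp (u : X -> bool) : classifier u -> measurable [set x | u x].
  move=> mu'; rewrite (_ : [set _ | _] = u @^-1` [set true])//.
  by rewrite -[X in measurable X]setTI; exact: mu'.
have mD1 : measurable D1.
  by apply: mp; apply: measurable_and => //; exact: measurable_neg.
have mD2 : measurable D2.
  by apply: mp; apply: measurable_and => //; exact: measurable_neg.
have mX A (b : bool) : measurable A -> measurable (A `*` [set b]).
  by move=> mA; exact: measurableX.
have prX A : measurable A ->
    pr P (A `*` [set true]) + pr P (A `*` [set false]) = pr mu A.
  move=> mA; rewrite -prU//; try exact: mX.
    rewrite -pr_marginal//; congr pr; apply/seteqP; split=> -[x b] /=.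
      by intuition.
    by case: b; intuition.
  by apply/disj_setPS => -[x b] /= [[_ ->] []].
have -> : loss_set t `\` loss_set s = D1 `*` [set false] `|` D2 `*` [set true].
  apply/seteqP; split=> -[x b] /=; rewrite /loss_set /D1 /D2 /=;
  by case: b; case: (t x); case: (s x); intuition.
have -> : loss_set s `\` loss_set t = D1 `*` [set true] `|` D2 `*` [set false].
  apply/seteqP; split=> -[x b] /=; rewrite /loss_set /D1 /D2 /=;
  by case: b; case: (t x); case: (s x); intuition.
have -> : [set x | t x != s x] = D1 `|` D2.
  apply/seteqP; split=> x /=; rewrite /D1 /D2 /=;
  by case: (t x); case: (s x); intuition.
rewrite !prU//; try exact: mX; last 3 first.
- by apply/disj_setPS => -[x b] /= [[_ ->] []].
- by apply/disj_setPS => -[x b] /= [[_ ->] []].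
- by apply/disj_setPS => x [/andP[tx _] /andP[/negP]].
have eta1 : pr P (D1 `*` [set true]) <= (1 - h) / 2 * pr mu D1.
  rewrite -lee_fin EFinM -!prE//; last exact: mX.
  rewrite etaP// -integral_cst//; apply: ge0_le_integral => //.
  - by move=> x _; rewrite lee_fin; case/andP: (eta01 x).
  - by apply/measurable_EFinP; exact: measurable_funS meta.
  - move=> x /andP[_]; rewrite /s /bayes lee_fin -ltNge => hx.
    by have := margin x; rewrite ltr0_norm; lra.
have eta2 : (1 + h) / 2 * pr mu D2 <= pr P (D2 `*` [set true]).
  rewrite -lee_fin EFinM -!prE//; last exact: mX.
  (* The sign of [h] is free here, while the integral comparison below wants a nonnegative smaller
     function. *)
  have [h0|h0] := ltP ((1 + h) / 2) 0.
    apply: (@le_trans _ _ 0%E); last exact: measure_ge0.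
    by apply: mule_le0_ge0; [rewrite lee_fin ltW|exact: measure_ge0].
  rewrite etaP// -integral_cst//; apply: ge0_le_integral => //.
  - by apply/measurable_EFinP; exact: measurable_funS meta.
  - move=> x /andP[_]; rewrite /s /bayes lee_fin => hx.
    by have := margin x; rewrite ger0_norm; lra.
by have := prX _ mD1; have := prX _ mD2; lra.
Qed.

End margin.

(** * From bracketing entropy to finite families of set brackets *)

Section bracketing_sets.
Context {d : measure_display} {X : measurableType d} {R : realType}.
Variables (mu : probability X R) (S : set (X -> bool)).

(* Between real-valued brackets f <= t <= g, a {0,1}-valued t is also bracketed
   by the indicators of f > 0 and 1 <= g, at no greater L1 distance. *)
Lemma bracketing_entropy_sets (eps K : R) :
  S !=set0 -> (bracketing_entropy eps S mu <= K%:E)%E ->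
  exists (N : nat) (A B : nat -> set X),
    [/\ (0 < N)%N, ln N%:R <= K + 1,
        forall i, measurable (A i) /\ measurable (B i) &
        forall t, S t -> exists i, [/\ (i < N)%N, A i `<=` t, t `<=` B i &
          pr mu (B i `\` A i) <= eps]].
Proof.
move=> [t0 St0] entS.
have c0 : 0 < 2 * expR K :> R by rewrite mulr_gt0// expR_gt0.
(* The bracketing number is an infimum, so an actual cover is extracted strictly below a larger
   value; the factor 2 costs $\ln 2 \le 1$, whence [K + 1]. *)
have : (bracketing_number eps S mu < (2 * expR K)%:E)%E.
  rewrite ltNge; apply/negP => le2.
  have : (lne (2 * expR K)%:E <= lne (bracketing_number eps S mu))%E.
    rewrite lee_lne// in_itv/= leey andbT.
      by rewrite lee_fin ltW.
    by apply: le_trans le2; rewrite lee_fin ltW.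
  move=> /le_trans /(_ entS); rewrite lne_EFin// lee_fin lnM ?posrE ?expR_gt0//.
  by rewrite expRK; have := @ln_gt0 R 2; rewrite ltr1n => /(_ isT); lra.
move=> /ereal_inf_ltP[_ [N [f [g [fg cover]]] <-]]; rewrite lte_fin => N2.
have N0 : (0 < N)%N.
  have [i _] := cover _ St0; exact: leq_ltn_trans (ltn_ord i).
(* Indexing by [nat], with a default function from [N] on, lets levels with different [N] share one
   index type. *)
pose F k := if insub k is Some i then f i else cst 0.
pose G k := if insub k is Some i then g i else cst 0.
have FE (i : 'I_N) : F i = f i by rewrite /F valK.
have GE (i : 'I_N) : G i = g i by rewrite /G valK.
have mF k : measurable_fun setT (F k).
  by rewrite /F; case: insubP => [i _ _|_] //; have [] := fg i.
have mG k : measurable_fun setT (G k).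
  by rewrite /G; case: insubP => [i _ _|_] //; have [] := fg i.
have mA k : measurable [set x | 0 < F k x].
  rewrite (_ : [set _ | _] = F k @^-1` `]0, +oo[).
    by rewrite -[X in measurable X]setTI; exact: mF.
  by apply/seteqP; split => x /=; rewrite in_itv/= andbT.
have mB k : measurable [set x | 1 <= G k x].
  rewrite (_ : [set _ | _] = G k @^-1` `[1, +oo[).
    by rewrite -[X in measurable X]setTI; exact: mG.
  by apply/seteqP; split => x /=; rewrite in_itv/= andbT.
exists N, (fun k => [set x | 0 < F k x]), (fun k => [set x | 1 <= G k x]); split=> //.
  have ln2 : ln 2 <= 1 :> R by have := @le_ln1Dx R 1; apply; lra.
  apply: (@le_trans _ _ (ln (2 * expR K))).
    by rewrite ler_ln ?posrE ?ltr0n// ltW.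
  by rewrite lnM ?posrE ?expR_gt0// expRK; lra.
move=> t St; have [i ti] := cover _ St; exists i; split=> //.
- move=> x /=; rewrite FE => fx; have /andP[+ _] := ti x.
  by move: fx; case: (t x) => //= /lt_le_trans h /h; rewrite ltxx.
- by move=> x tx /=; rewrite GE; have /andP[_] := ti x; rewrite /= tx.
have [mf mg] := fg i; rewrite Lnorm1 => norm1.
rewrite -lee_fin -prE; last exact: measurableD.
apply: le_trans norm1.
have mfg : measurable_fun setT (fun x => (f i x - g i x)%:E).
  by apply/measurable_EFinP; exact: measurable_funB.
(* Markov's inequality at level 1: on the difference of the two sets $f \le 0$ and $g \ge 1$. *)
apply: le_trans (le_integral_abse mu measurableT mfg (@ltr01 R)).
rewrite mul1e setTI; apply: le_measure; rewrite ?inE.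
- exact: measurableD.
- rewrite -[X in measurable X]setTI.
  apply: emeasurable_fun_c_infty => //; exact: measurableT_comp.
- move=> x /= []; rewrite FE GE => gx /negP; rewrite -leNgt => fx.
  by rewrite lee_fin ler0_norm; lra.
Qed.

End bracketing_sets.

(** * Chaining and integration of the pathwise bound *)

Section chaining.
Context {d : measure_display} {T : measurableType d} {R : realType}.
Variable P : probability T R.

(** Each [G k] comes from one use of the finite-class bound on all pairs of sets from consecutive
    levels. It therefore serves every path [i], even one that depends on the sample; the links then
    telescope. *)
Lemma chain_deviation (n : nat) (D : nat -> nat -> set T) (D0 : set T)
    (N : nat -> nat) (th : nat -> R) (J : nat) :
  (0 < n)%N -> measurable D0 ->
  (forall k, (k <= J)%N -> [/\ (0 < N k)%N, 0 < th k <= 2^-1 &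
                              forall i, measurable (D k i)]) ->
  exists G : nat -> n.-tuple T -> R,
    (forall k, (k <= J)%N -> [/\ measurable_fun setT (G k),
       forall z, 0 <= G k z & (\int[iid_law P n]_z (G k z)%:E <= 1)%E]) /\
    forall z (i : nat -> nat), (forall k, (k <= J)%N -> (i k < N k)%N) ->
      deviation P z (D J (i J)) - deviation P z D0 <=
      2 * th 0%N * pdist P (D 0%N (i 0%N)) D0
        + (ln (N 0%N)%:R + G 0%N z) / (n%:R * th 0%N)
      + \sum_(k < J) (2 * th k.+1 * pdist P (D k.+1 (i k.+1)) (D k (i k))
        + (ln (N k.+1)%:R + ln (N k)%:R + G k.+1 z) / (n%:R * th k.+1)).
Proof.
move=> n0 mD0 hyp.
(* Level 0 is compared with the fixed set [D0], so [j] matters only from level 1 on. *)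
pose link k (G : n.-tuple T -> R) := forall z (i j : nat),
  match k with
  | 0%N => (i < N 0%N)%N -> deviation P z (D 0%N i) - deviation P z D0 <=
      2 * th 0%N * pdist P (D 0%N i) D0
        + (ln (N 0%N)%:R + G z) / (n%:R * th 0%N)
  | m.+1 => (i < N m.+1)%N -> (j < N m)%N ->
      deviation P z (D m.+1 i) - deviation P z (D m j) <=
      2 * th m.+1 * pdist P (D m.+1 i) (D m j)
        + (ln (N m.+1)%:R + ln (N m)%:R + G z) / (n%:R * th m.+1)
  end.
have /choice[G GP] : forall k, exists G : n.-tuple T -> R, (k <= J)%N ->
    [/\ measurable_fun setT G, forall z, 0 <= G z,
        (\int[iid_law P n]_z (G z)%:E <= 1)%E & link k G].
  case=> [|k].
    have [N0 th0 mD] := hyp _ (leq0n J).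
    have cN : (0 < #|{: 'I_(N 0%N)}|)%N by rewrite card_ord.
    have [G [mG G0 intG GP]] := finite_class_deviation P cN n0 th0
      (fun i : 'I_(N 0%N) => mD i) (fun=> mD0).
    exists G => _; split=> // z i j iN.
    by have := GP z (Ordinal iN); rewrite card_ord.
  have [kJ|kJ] := leqP k.+1 J; last by exists (cst 0).
  have [N0 th0 mD] := hyp _ kJ; have [N0' _ mD'] := hyp _ (ltnW kJ).
  have cN : (0 < #|{: 'I_(N k.+1) * 'I_(N k)}|)%N.
    by rewrite card_prod !card_ord muln_gt0 N0.
  have [G [mG G0 intG GP]] := finite_class_deviation P cN n0 th0
    (fun i : 'I_(N k.+1) * 'I_(N k) => mD i.1) (fun i => mD' i.2).
  exists G => _; split=> // z i j iN jN.
  have := GP z (Ordinal iN, Ordinal jN).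
  by rewrite card_prod !card_ord natrM lnM// posrE ltr0n.
exists G; split; first by move=> k /GP[].
move=> z i iN.
have : forall m, (m <= J)%N ->
    deviation P z (D m (i m)) - deviation P z D0 <=
    2 * th 0%N * pdist P (D 0%N (i 0%N)) D0
      + (ln (N 0%N)%:R + G 0%N z) / (n%:R * th 0%N)
    + \sum_(k < m) (2 * th k.+1 * pdist P (D k.+1 (i k.+1)) (D k (i k))
      + (ln (N k.+1)%:R + ln (N k)%:R + G k.+1 z) / (n%:R * th k.+1)).
  elim=> [|m ih] mJ.
    rewrite big_ord0 addr0; have [_ _ _ /(_ z (i 0%N) 0%N)] := GP _ mJ; apply.
    exact: iN.
  have [_ _ _ /(_ z (i m.+1) (i m))] := GP _ mJ.
  move=> /(_ (iN _ mJ) (iN _ (ltnW mJ))); have := ih (ltnW mJ).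
  by rewrite big_ord_recr /=; lra.
exact.
Qed.

(* No measurability of f is needed: the integral of a nonnegative function is
   the supremum of the integrals of the simple functions below it. *)
Lemma expectation_le_affine (n : nat) (f : n.-tuple T -> R) (c : R) (m : nat)
    (b : nat -> R) (G : nat -> n.-tuple T -> R) :
  (forall z, 0 <= f z) -> 0 <= c -> (forall k, (k < m)%N -> 0 <= b k) ->
  (forall k, (k < m)%N -> [/\ measurable_fun setT (G k),
     forall z, 0 <= G k z & (\int[iid_law P n]_z (G k z)%:E <= 1)%E]) ->
  (forall z, f z <= c + \sum_(k < m) b k * G k z) ->
  ('E_(iid_law P n)[f] <= (c + \sum_(k < m) b k)%:E)%E.
Proof.
move=> f0 c0 b0 GP fG; rewrite unlock.
have bG0 (k : 'I_m) z : 0 <= b k * G k z.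
  by have [_ G0 _] := GP k (ltn_ord k); rewrite mulr_ge0 ?b0.
apply: le_trans (ge0_le_integralT _ _ (_ : forall z, _ <=
    c%:E + \sum_(k < m) (b k * G k z)%:E)%E) _.
- by move=> z; rewrite lee_fin.
- by move=> z; rewrite sumEFin -EFinD lee_fin.
have mbG (k : 'I_m) : measurable_fun setT (fun z => (b k * G k z)%:E).
  have [mG _ _] := GP k (ltn_ord k).
  by apply/measurable_EFinP; exact: measurable_funM.
rewrite ge0_integralD//; last 2 first.
- by move=> z _; rewrite sumEFin lee_fin sumr_ge0.
- exact: emeasurable_sum.
rewrite EFinD; apply: leeD.
  rewrite integral_cst// -[leRHS]mule1; apply: lee_pmul => //.
  exact: probability_le1.
rewrite ge0_integral_sum//; last by move=> k z _; rewrite lee_fin.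
rewrite -sumEFin; apply: lee_sum => k _.
have [mG G0 iG] := GP k (ltn_ord k); have bk := b0 k (ltn_ord k).
under eq_integral do rewrite EFinM.
rewrite ge0_integralZl_EFin//.
- by rewrite -[leRHS]mule1 lee_pmul ?lee_fin// integral_ge0// => z _; rewrite lee_fin.
- by move=> z _; rewrite lee_fin.
- exact/measurable_EFinP.
Qed.

End chaining.

(** * The rate and the choice of scales *)

Section scales.
Context {R : realType}.
Variables (m r : R).
Implicit Types g : R.

Definition rate g : R := (m * g `^ (1 - r)) `^ (- (r + 1)^-1).

(** The factor by which $\delta^{(1-r)/2} m^{-1/2}$, the bound of one link up to a constant, shrinks
    when $\delta$ is halved. *)
Definition chain_ratio : R := 2^-1 `^ ((1 - r) / 2).

Lemma chain_ratio_lt1 : r < 1 -> chain_ratio < 1.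
Proof.
move=> r1.
have <- : 1 `^ ((1 - r) / 2) = 1 :> R by rewrite powR1.
rewrite /chain_ratio gt0_ltr_powR ?nnegrE ?divr_gt0 ?subr_gt0//.
by rewrite invf_lt1 ?ltr1n.
Qed.

Let arg_gt0 g : 0 < m -> 0 < g -> 0 < m * g `^ (1 - r).
Proof. by move=> m0 g0; rewrite mulr_gt0// powR_gt0. Qed.

Lemma rate_gt0 g : 0 < m -> 0 < g -> 0 < rate g.
Proof. by move=> m0 g0; rewrite powR_gt0// arg_gt0. Qed.

(** The equation for the rate on which the exponent computations below rest. *)
Lemma rate_powR g : 0 < m -> 0 < r -> 0 < g ->
  rate g `^ (1 + r) = (m * g `^ (1 - r))^-1.
Proof.
move=> m0 r0 g0; rewrite /rate -powRrM (_ : - _ * _ = -1); last first.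
  by field; rewrite gt_eqF// addr_gt0.
by rewrite powR_inv1// ltW// arg_gt0.
Qed.

Lemma le_rate g g' : 0 < m -> 0 < r < 1 -> 0 < g -> g <= g' ->
  rate g' <= rate g.
Proof.
move=> m0 /andP[r0 r1] g0 gg'; have g'0 : 0 < g' by exact: lt_le_trans gg'.
have pos x : 0 < x -> 0 < (m * x `^ (1 - r)) `^ (r + 1)^-1.
  by move=> x0; exact/powR_gt0/arg_gt0.
rewrite /rate !powRN lef_pV2 ?posrE; [|exact: pos|exact: pos].
have ri : 0 <= (r + 1)^-1 by rewrite invr_ge0 addr_ge0// ltW.
apply: (ge0_ler_powR ri); rewrite ?nnegrE; try by apply/ltW/arg_gt0.
rewrite ler_pM2l//.
have ri' : 0 <= 1 - r by rewrite subr_ge0 ltW.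
by apply: (ge0_ler_powR ri'); rewrite ?nnegrE//; exact: ltW.
Qed.

(** The exponent is $-(1-(1-r)/2)/(r+1) = -1/2$: the two rates of the theorem cross at $g =
    m^{-1/2}$. *)
Lemma rate_invsqrt : 0 < m -> 0 < r -> rate (m `^ (- 2^-1)) = m `^ (- 2^-1).
Proof.
move=> m0 r0.
rewrite /rate -powRrM -{1}(powRr1 (ltW m0)) -powRD; last first.
  by apply/implyP => _; rewrite gt_eqF.
rewrite -powRrM; congr (_ `^ _); field.
by rewrite gt_eqF// addr_gt0.
Qed.

Lemma halving_stops (x a : R) : 0 < a -> a / 2 <= x ->
  exists J, x / 2 ^+ J <= a /\ forall k, (k <= J)%N -> a / 2 <= x / 2 ^+ k.
Proof.
move=> a0 ax.
have ex : exists k, x / 2 ^+ k <= a.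
  have x0 : 0 < x by apply: lt_le_trans ax; rewrite divr_gt0.
  (* Any integer [k] above [x / a] will do, since $k < 2^k$. *)
  exists (Num.truncn (x / a)).+1; rewrite ler_pdivrMr ?exprn_gt0// mulrC -ler_pdivrMr//.
  apply: (le_trans (ltW (truncnS_gt _))).
  by rewrite -natrX ler_nat ltnW// ltn_expl.
(* [J] is minimal, so for $1 \le k \le J$ the size before the last halving still exceeds [a]. *)
exists (ex_minn ex); case: ex_minnP => J Ja Jmin; split=> // -[_|k kJ].
  by rewrite expr0 divr1.
have /negP : ~ (x / 2 ^+ k <= a) by move=> /Jmin; rewrite leqNgt kJ.
rewrite -ltNge exprS => /ltW xa.
rewrite (_ : x / (2 * 2 ^+ k) = (x / 2 ^+ k) / 2); first by rewrite ler_pM2r.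
by field; rewrite expf_neq0//=.
Qed.

(** At a link, $\theta_k$ balances the variance cost $\theta\delta$ against the entropy cost
    $\delta^{-r}/(m\theta)$, up to constants; both are then of order $\delta_k^{(1-r)/2} m^{-1/2}$,
    which is summable geometrically because $r < 1$. At level 0, $\theta_0$ is imposed by the
    absorption argument. *)
Lemma chaining_scales g : 1 <= m -> 0 < r < 1 -> m `^ (- 2^-1) <= g <= 1 ->
  exists (delta th s : nat -> R) (J : nat),
    [/\ forall k, (k <= J)%N -> (0 < delta k < 1) && (0 < th k <= 2^-1),
        delta J <= rate g,
        [/\ th 0%N = g / 4, g * delta 0%N <= rate g &
            delta 0%N `^ (- r) / (m * th 0%N) <= 8 * rate g],
        forall k, (k < J)%N -> [/\ delta k = 2 * delta k.+1, 0 <= s k,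
           th k.+1 * delta k.+1 <= s k &
           delta k.+1 `^ (- r) / (m * th k.+1) <= s k] &
        \sum_(k < J) s k <= 4 * (1 - chain_ratio)^-1 * rate g].
Proof.
move=> m1 /[dup] r01 /andP[r0 r1] /andP[mg g1].
have m0 : 0 < m by apply: lt_le_trans m1.
have g0 : 0 < g by apply: lt_le_trans mg; rewrite powR_gt0.
have m20 : 0 < m `^ (- 2^-1) by exact: powR_gt0.
have eg : rate g <= g.
  by apply: (le_trans _ mg); have := le_rate m0 r01 m20 mg; rewrite rate_invsqrt.
have ae : rate 1 <= rate g by exact: le_rate.
have aE : rate 1 `^ (1 + r) = m^-1 by rewrite rate_powR// powR1 mulr1.
have eE := rate_powR m0 r0 g0.
have a0 := rate_gt0 m0 ltr01; have e0 := rate_gt0 m0 g0.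
move: (rate 1) (rate g) eg ae aE eE a0 e0 => a e eg ae aE eE a0 e0.
(* The initial size $\delta_0$; it is below 1 because $e \le g$. *)
pose x := e / (2 * g).
have x0 : 0 < x by rewrite divr_gt0// mulr_gt0.
have x1 : x < 1 by rewrite ltr_pdivrMr ?mulr_gt0//; lra.
have [J [Ja aJ]] : exists J, x / 2 ^+ J <= a /\
    forall k, (k <= J)%N -> a / 2 <= x / 2 ^+ k.
  apply: halving_stops => //; rewrite ler_pdivlMr ?mulr_gt0//.
  rewrite (_ : a / 2 * (2 * g) = a * g); last by field.
  by apply: le_trans ae; rewrite ger_pMr.
pose delta k := x / 2 ^+ k.
have d0 k : 0 < delta k by rewrite divr_gt0// exprn_gt0.
have d1 k : delta k < 1.
  by apply: le_lt_trans x1; rewrite ler_pdivrMr ?exprn_gt0// ler_pMr// exprn_ege1// ler1n.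
pose s k := delta k `^ ((1 - r) / 2) * m `^ (- 2^-1).
have s0 k : 0 < s k by rewrite mulr_gt0// powR_gt0.
have s2 k : s k ^+ 2 * m = delta k `^ (1 - r).
  rewrite exprMn -!powR_mulrn ?powR_ge0// -!powRrM.
  rewrite (_ : - 2^-1 * 2%:R = -1); last by field.
  rewrite powR_inv1 ?(ltW m0)// -mulrA mulVf ?gt_eqF// mulr1; congr (_ `^ _).
  by field.
(* The divisor 4 leaves room for $\theta_k \le 1/2$: what is needed is $s_k \le 2\delta_k$, that is
   $1 \le 4m\delta_k^{1+r}$, which follows from $\delta_k \ge a/2$ and $a^{1+r} = 1/m$. *)
pose th k := if k is 0%N then g / 4 else s k / (4 * delta k).
exists delta, th, (fun k => 4 * s k.+1), J; split.
- move=> k kJ; rewrite d0 d1 /=; case: k kJ => [|k] kJ /=.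
    by apply/andP; split; lra.
  have dk0 := d0 k.+1; have sk := s0 k.+1.
  have dk4 : 0 < 4 * delta k.+1 by lra.
  rewrite (divr_gt0 sk dk4) ler_pdivrMr//=.
  suff : s k.+1 <= 2 * delta k.+1 by lra.
  rewrite -ler_sqr ?nnegrE; [|exact: ltW|by lra].
  rewrite -(ler_pM2r m0) s2.
  have dE : delta k.+1 `^ (1 - r) * delta k.+1 `^ (1 + r) = delta k.+1 ^+ 2.
    rewrite -powRD; last by apply/implyP => _; rewrite gt_eqF.
    by rewrite -powR_mulrn ?ltW//; congr (_ `^ _); ring.
  have : (a / 2) `^ (1 + r) <= delta k.+1 `^ (1 + r).
    have ri : 0 <= 1 + r by rewrite addr_ge0// ltW.
    apply: (ge0_ler_powR ri); rewrite ?nnegrE; last exact: aJ.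
      by rewrite divr_ge0// ltW.
    exact: ltW.
  rewrite powRM ?invr_ge0 ?(ltW a0)// aE => ad.
  have q : 4^-1 <= 2^-1 `^ (1 + r) :> R.
    rewrite (_ : 4^-1 = 2^-1 `^ 2%:R); last by rewrite powR_mulrn//; field.
    have h2 : (0 < 2^-1 :> R) && (2^-1 <= 1 :> R).
      by rewrite invr_gt0 invf_le1 ?ler1n// ltr0n.
    by apply: (ger_powR h2); lra.
  have ad' : 1 <= 4 * m * delta k.+1 `^ (1 + r).
    rewrite -ler_pdivrMl ?mulr_gt0//; apply: le_trans ad.
    by rewrite invfM mulr1 mulrC ler_pM2l ?invr_gt0.
  rewrite exprMn -dE.
  have p0 : 0 < delta k.+1 `^ (1 - r) by rewrite powR_gt0.
  have := ad'; rewrite -(ler_pM2l p0) mulr1 => /le_trans; apply.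
  by rewrite le_eqVlt; apply/orP; left; apply/eqP; ring.
- exact: le_trans ae.
- split=> //.
    rewrite /delta expr0 divr1 /x (_ : g * _ = e / 2); first by lra.
    by field; rewrite gt_eqF.
  (* The rate equation gives $e^{-r} = e\,m\,g^{1-r}$, so the quotient equals $4 \cdot 2^r e \le
     8e$. *)
  rewrite /th /delta expr0 divr1 /x.
  have g20 : 0 < 2 * g by lra.
  rewrite powRM ?invr_ge0 ?(ltW e0) ?(ltW g20)//.
  rewrite -[(2 * g)^-1]powR_inv1 ?(ltW g20)//.
  rewrite -powRrM mulrN mulN1r opprK powRM ?(ltW g0)//.
  have eN : e `^ (- r) = e * (m * g `^ (1 - r)).
    rewrite -[m * _]invrK -eE -powRN -{2}[e]powRr1 ?ltW// -powRD; last first.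
      by apply/implyP => _; rewrite gt_eqF.
    by congr (_ `^ _); ring.
  rewrite eN.
  have gg : g `^ (1 - r) * g `^ r = g.
    rewrite -powRD; last by apply/implyP => _; rewrite gt_eqF.
    by rewrite subrK powRr1// ltW.
  rewrite (_ : _ / _ = 4 * e * 2 `^ r * (g `^ (1 - r) * g `^ r) / g); last first.
    by field; rewrite !gt_eqF.
  rewrite gg mulfK ?gt_eqF//.
  have : 2 `^ r <= 2 :> R by apply: ler1_powR; [rewrite ler1n|exact: ltW].
  by rewrite -(ler_pM2l e0); lra.
- move=> k kJ; have dk := d0 k.+1; have sk := s0 k.+1; split.
  + by rewrite /delta exprS; field; rewrite expf_neq0.
  + by rewrite mulr_ge0// ltW.
  + rewrite /th (_ : _ / _ * _ = s k.+1 / 4); first by lra.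
    by field; rewrite gt_eqF.
  + rewrite /th le_eqVlt; apply/orP; left; apply/eqP.
    have -> : delta k.+1 `^ (- r) = s k.+1 ^+ 2 * m / delta k.+1.
      rewrite s2 -[X in _ / X]powRr1 ?ltW// -powRN -powRD; last first.
        by apply/implyP => _; rewrite gt_eqF.
      by congr (_ `^ _); ring.
    by field; rewrite !gt_eqF.
- have q1 := chain_ratio_lt1 r1; set q := chain_ratio in q1 *.
  have q0 : 0 <= q by exact: powR_ge0.
  have sE k : s k = s 0%N * q ^+ k.
    rewrite /s /delta expr0 divr1 powRM ?invr_ge0 ?exprn_ge0 ?ltW//.
    rewrite -exprVn -[_ ^+ k in LHS]powR_mulrn ?invr_ge0// powRAC.
    by rewrite powR_mulrn ?powR_ge0// -/q; ring.
  (* After squaring: $m s_0^2 = \delta_0^{1-r} \le (e/g)^{1-r} = m e^2$, by the rate equation. *)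
  have s0e : s 0%N <= e.
    rewrite -ler_sqr ?nnegrE; [|exact: ltW|exact: ltW].
    rewrite -(ler_pM2r m0) s2.
    apply: (@le_trans _ _ ((e / g) `^ (1 - r))).
      have ri : 0 <= 1 - r by rewrite subr_ge0 ltW.
      apply: (ge0_ler_powR ri); rewrite ?nnegrE; try exact: ltW.
        by rewrite divr_ge0// ltW.
      rewrite /delta expr0 divr1 /x ler_pM2l// lef_pV2 ?posrE ?mulr_gt0//; lra.
    rewrite powRM ?invr_ge0 ?(ltW e0) ?(ltW g0)//.
    rewrite -[g^-1]powR_inv1 ?(ltW g0)// powRAC.
    rewrite powR_inv1 ?powR_ge0//.
    have -> : e ^+ 2 = e `^ (1 - r) * e `^ (1 + r).
      rewrite -powRD; last by apply/implyP => _; rewrite gt_eqF.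
      by rewrite -powR_mulrn ?ltW//; congr (_ `^ _); ring.
    rewrite eE le_eqVlt; apply/orP; left; apply/eqP.
    by field; rewrite !gt_eqF// powR_gt0.
  rewrite -mulr_sumr -mulrA ler_pM2l//.
  under eq_bigr do rewrite sE.
  rewrite -mulr_sumr mulrC; apply: ler_pM => //.
    by rewrite sumr_ge0// => k _; rewrite exprn_ge0.
    by rewrite ltW.
  rewrite -[leRHS]mul1r ler_pdivlMr ?subr_gt0//.
  (* The links start at index 1; adding one power of [q] less gives the sum that telescopes against
     [1 - q]. *)
  have le_geom : \sum_(k < J) q ^+ k.+1 <= \sum_(k < J) q ^+ k.
    apply: ler_sum => k _; rewrite exprS.
    exact: (ler_piMl (exprn_ge0 k q0) (ltW q1)).
  apply: (le_trans (ler_wpM2r _ le_geom)); first by rewrite subr_ge0 ltW.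
  by rewrite mulrC -opprB mulNr -subrX1 opprB lerBlDr lerDl exprn_ge0.
Qed.

End scales.

(** * The risk bound for the empirical risk minimizer *)

Section erm_bound.
Context {d : measure_display} {X : measurableType d} {R : realType}.
Variables (mu : probability X R) (P : probability (X * bool)%type R).
Variables (S : set (X -> bool)) (eta : X -> R) (K1 r h : R).

(** The scales are built for [g], which may exceed the true margin [h] as long as replacing one by
    the other costs at most [e]. This covers both rates at once. *)
Lemma erm_expected_excess_risk (n : nat)
    (shat : n.-tuple (X * bool)%type -> X -> bool) (g : R)
    (K := K1 + 1) (e := rate n%:R r g) :
  0 < K1 -> 0 < r < 1 -> (0 < n)%N ->
  (forall t, S t -> classifier t) ->
  (forall eps : R, 0 < eps -> eps < 1 ->
     (bracketing_entropy eps S mu <= (K1 * eps `^ (- r))%:E)%E) ->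
  margin_model h S mu (P, eta) -> 0 <= h ->
  n%:R `^ (- 2^-1) <= g <= 1 ->
  (forall w, 0 <= w <= 1 -> g * w <= h * w + e) ->
  (forall z, S (shat z)) ->
  (forall z t, S t -> empirical_risk z (shat z) <= empirical_risk z t :> R) ->
  (expected_excess_risk P eta shat <=
   ((20 + 16 * K + (14 + 4 * K) * (4 * (1 - chain_ratio r)^-1)) * e)%:E)%E.
Proof.
move=> K10 r01 n0 Scl ent [/= marg reg margin bayesS] h0 mg gw shatS erm.
have K0 : 0 < K by rewrite /K addr_gt0.
have m1 : 1 <= n%:R :> R by rewrite ler1n.
have m0 : 0 < n%:R :> R by rewrite ltr0n.
have [delta [th [s [J [scale deltaJ [th0E gdelta0 lvl0] lvl sum_s]]]]] :=
  chaining_scales m1 r01 mg.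
have /andP[r0 r1] := r01.
have clb : classifier (bayes eta) by exact: Scl.
have d1 k : (k <= J)%N -> 1 <= delta k `^ (- r).
  by move=> /scale/andP[/andP[dk0 dk1] _]; rewrite powRN_ge1 ?dk0 ?ltW.
have /choice[N /choice[A /choice[B brackets]]] :
    forall k, exists N A B, (k <= J)%N ->
    [/\ (0 < N)%N, ln N%:R <= K * delta k `^ (- r),
        forall i, measurable (A i) /\ measurable (B i) &
        forall t, S t -> exists i, [/\ (i < N)%N, A i `<=` t, t `<=` B i &
          pr mu (B i `\` A i) <= delta k]].
  move=> k; have [kJ|kJ] := leqP k J; last first.
    by exists 0%N, (fun=> set0), (fun=> set0).
  have /andP[/andP[dk0 dk1] _] := scale _ kJ.
  have S0 : S !=set0 by exists (bayes eta).
  have [N [A [B [N0 lnN mAB cover]]]] := bracketing_entropy_sets S0 (ent _ dk0 dk1).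
  exists N, A, B => _; split=> //; apply: le_trans lnN _.
  (* The additive 1 from the extraction of a cover is absorbed since $\delta_k^{-r} \ge 1$. *)
  by rewrite /K mulrDl mul1r lerD2l d1.
have mAB k i : (k <= J)%N -> measurable (A k i) /\ measurable (B k i).
  by move=> kJ; have [_ _ + _] := brackets _ kJ; apply.
pose D k i := bracket_loss (A k i) (B k i).
have mD k i : (k <= J)%N -> measurable (D k i : set (X * bool)).
  by move=> /(mAB k i)[mA mB]; exact: measurable_bracket_loss.
have mL0 := measurable_loss_set clb.
have [G [GP chain]] : exists G : nat -> n.-tuple (X * bool)%type -> R,
    (forall k, (k <= J)%N -> [/\ measurable_fun setT (G k),
       forall z, 0 <= G k z & (\int[iid_law P n]_z (G k z)%:E <= 1)%E]) /\
    forall z (i : nat -> nat), (forall k, (k <= J)%N -> (i k < N k)%N) ->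
      deviation P z (D J (i J)) - deviation P z (loss_set (bayes eta)) <=
      2 * th 0%N * pdist P (D 0%N (i 0%N)) (loss_set (bayes eta))
        + (ln (N 0%N)%:R + G 0%N z) / (n%:R * th 0%N)
      + \sum_(k < J) (2 * th k.+1 * pdist P (D k.+1 (i k.+1)) (D k (i k))
        + (ln (N k.+1)%:R + ln (N k)%:R + G k.+1 z) / (n%:R * th k.+1)).
  apply: chain_deviation => // k kJ; have [Nk _ _ _] := brackets _ kJ.
  by have /andP[_ thk] := scale _ kJ; split=> // i; exact: mD.
pose ell z := excess_risk P (bayes eta) (shat z).
have low z : h * pr mu [set x | shat z x != bayes eta x] <= ell z.
  exact: (margin_le_excess_risk marg reg margin clb (Scl _ (shatS z))).
have ell0 z : 0 <= ell z.
  by apply: le_trans (low z); rewrite mulr_ge0// pr_ge0.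
have mth k : (k <= J)%N -> 0 < n%:R * th k.
  by move=> /scale/andP[_ /andP[thk _]]; rewrite mulr_gt0.
have inv_th k : (k <= J)%N ->
    (n%:R * th k)^-1 <= delta k `^ (- r) / (n%:R * th k).
  move=> kJ; have pk : 0 <= (n%:R * th k)^-1 by rewrite invr_ge0 ltW// mth.
  by have := ler_wpM2r pk (d1 k kJ); rewrite mul1r.
have e0 : 0 < e.
  apply: rate_gt0 => //; have /andP[+ _] := mg.
  by apply: lt_le_trans; exact: powR_gt0.
(* The chain bounds [ell z] by [ell z / 2] plus the other terms; moving the half to the left doubles
   every coefficient. *)
have bounded z : ell z <= (4 + 16 * K) * e + (12 + 4 * K) * (\sum_(k < J) s k)
    + \sum_(k < J.+1) 2 / (n%:R * th k) * G k z.
  have St := shatS z; have clt := Scl _ St.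
  have /choice[i iP] : forall k, exists i, (k <= J)%N ->
      [/\ (i < N k)%N, A k i `<=` shat z, shat z `<=` B k i &
          pr mu (B k i `\` A k i) <= delta k].
    move=> k; have [kJ|kJ] := leqP k J; last by exists 0%N.
    by have [_ _ _ /(_ _ St)[i ?]] := brackets _ kJ; exists i.
  have mL := measurable_loss_set clt.
  have near_loss k : (k <= J)%N ->
      pdist P (loss_set (shat z)) (D k (i k)) <= delta k.
    move=> kJ; have [_ At tB] := iP _ kJ; have [mA mB] := mAB k (i k) kJ.
    by apply: le_trans; exact: pdist_bracket_loss.
  (* The Bayes classifier belongs to [S], so the minimizer has no larger empirical risk; passing to
     the last bracket costs $\delta_J$. *)
  have step0 : ell z <= deviation P z (D J (i J))
      - deviation P z (loss_set (bayes eta)) + delta J.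
    have [_ At tB BA] := iP _ (leqnn J); have [mA mB] := mAB J (i J) (leqnn J).
    have := deviation_bracket_loss marg z mA mB clt At tB.
    have := erm z _ bayesS; rewrite -!empirical_loss_set /ell /excess_risk.
    rewrite /risk -/(loss_set _) -/(loss_set _) -/(pr P _) -/(pr P _).
    by rewrite /deviation /D; lra.
  have link k : (k < J)%N ->
      2 * th k.+1 * pdist P (D k.+1 (i k.+1)) (D k (i k))
        + (ln (N k.+1)%:R + ln (N k)%:R + G k.+1 z) / (n%:R * th k.+1) <=
      (6 + 2 * K) * s k + G k.+1 z / (n%:R * th k.+1).
    move=> kJ; have [dE s0 thd dth] := lvl _ kJ.
    have /andP[/andP[dk0 _] /andP[thk _]] := scale _ kJ.
    have /andP[/andP[dk0' _] _] := scale _ (ltnW kJ).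
    (* Both brackets contain [shat z], whose loss set serves as midpoint: $\delta_{k+1} + \delta_k =
       3\delta_{k+1}$. *)
    have pd : pdist P (D k.+1 (i k.+1)) (D k (i k)) <= 3 * delta k.+1.
      have mDk := mD k (i k) (ltnW kJ).
      apply: (le_trans (pdist_triangle P (mD k.+1 (i k.+1) kJ) mL mDk)).
      rewrite pdistC; have := near_loss _ kJ; have := near_loss _ (ltnW kJ).
      by rewrite [in X in X -> _]dE; lra.
    have [_ lnN1 _ _] := brackets _ kJ; have [_ lnN0 _ _] := brackets _ (ltnW kJ).
    have dle : delta k `^ (- r) <= delta k.+1 `^ (- r).
      rewrite !powRN lef_pV2 ?posrE ?powR_gt0//.
      by apply: (ge0_ler_powR (ltW r0)); rewrite ?nnegrE; [exact: ltW..|lra].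
    have lnN : ln (N k.+1)%:R + ln (N k)%:R <= 2 * K * delta k.+1 `^ (- r).
      by have := ler_wpM2l (ltW K0) dle; lra.
    have ln_le : (ln (N k.+1)%:R + ln (N k)%:R) / (n%:R * th k.+1) <= 2 * K * s k.
      have pk : 0 <= (n%:R * th k.+1)^-1 by rewrite invr_ge0 ltW// mth.
      have K2 : 0 <= 2 * K by lra.
      apply: (le_trans (ler_wpM2r pk lnN)).
      by have := ler_wpM2l K2 dth; rewrite mulrA.
    have pd_le : 2 * th k.+1 * pdist P (D k.+1 (i k.+1)) (D k (i k)) <= 6 * s k.
      have th2 : 0 <= 2 * th k.+1 by lra.
      by apply: (le_trans (ler_wpM2l th2 pd)); lra.
    by rewrite mulrDl; lra.
  have link0 : 2 * th 0%N * pdist P (D 0%N (i 0%N)) (loss_set (bayes eta))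
        + (ln (N 0%N)%:R + G 0%N z) / (n%:R * th 0%N) <=
      ell z / 2 + e + 8 * K * e + G 0%N z / (n%:R * th 0%N).
    set w := pr mu [set x | shat z x != bayes eta x].
    have mne := measurable_neq clb clt.
    have w01 : 0 <= w <= 1 by rewrite pr_ge0 pr_le1.
    have [_ lnN _ _] := brackets _ (leq0n J).
    have pd : pdist P (D 0%N (i 0%N)) (loss_set (bayes eta)) <= delta 0%N + w.
      apply: (le_trans (pdist_triangle P (mD 0%N (i 0%N) (leq0n J)) mL mL0)).
      by rewrite pdistC lerD// ?near_loss//; exact: pdist_loss_set.
    have ln_le : ln (N 0%N)%:R / (n%:R * th 0%N) <= 8 * K * e.
      have pk : 0 <= (n%:R * th 0%N)^-1 by rewrite invr_ge0 ltW// mth.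
      apply: (le_trans (ler_wpM2r pk lnN)).
      by have := ler_wpM2l (ltW K0) lvl0; rewrite -/e; lra.
    (* Localization: with $\theta_0 = g/4$ the left side is at most $g\delta_0/2 + gw/2 \le e/2 +
       (hw+e)/2$, and $hw$ is at most [ell z] by the margin. *)
    have pd_le : 2 * th 0%N * pdist P (D 0%N (i 0%N)) (loss_set (bayes eta))
        <= ell z / 2 + e.
      have /andP[_ /andP[thk _]] := scale _ (leq0n J).
      have th2 : 0 <= 2 * th 0%N by lra.
      apply: (le_trans (ler_wpM2l th2 pd)); rewrite th0E.
      have := gw _ w01; have := low z; rewrite -/w; move: gdelta0; rewrite -/e.
      by lra.
    by rewrite mulrDl; lra.
  have := chain z i (fun k kJ => let: And4 h _ _ _ := iP k kJ in h).
  have : \sum_(k < J) (2 * th k.+1 * pdist P (D k.+1 (i k.+1)) (D k (i k))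
        + (ln (N k.+1)%:R + ln (N k)%:R + G k.+1 z) / (n%:R * th k.+1)) <=
      (6 + 2 * K) * (\sum_(k < J) s k)
      + \sum_(k < J) G k.+1 z / (n%:R * th k.+1).
    by rewrite mulr_sumr -big_split /=; apply: ler_sum => k _; exact: link.
  have -> : \sum_(k < J.+1) 2 / (n%:R * th k) * G k z =
      2 * (G 0%N z / (n%:R * th 0%N))
      + 2 * \sum_(k < J) G k.+1 z / (n%:R * th k.+1).
    rewrite big_ord_recl /= mulr_sumr; congr (_ + _); first by ring.
    by apply: eq_bigr => k _; rewrite /= /bump add1n; ring.
  by move: step0 link0 deltaJ; rewrite -/e; lra.
have sum_s0 : 0 <= \sum_(k < J) s k.
  by apply: sumr_ge0 => k _; have [_ + _ _] := lvl _ (ltn_ord k).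
have c0 : 0 <= (4 + 16 * K) * e + (12 + 4 * K) * (\sum_(k < J) s k).
  by rewrite addr_ge0// mulr_ge0// ?ltW//; lra.
apply: le_trans (expectation_le_affine ell0 c0 (b := fun k => 2 / (n%:R * th k))
  (G := G) (m := J.+1) _ _ bounded) _.
- by move=> k; rewrite ltnS => /mth/ltW kJ; rewrite divr_ge0.
- by move=> k; rewrite ltnS; exact: GP.
rewrite lee_fin.
(* The mean of the terms in [G] is dominated by the entropy terms, again because $\delta_k^{-r} \ge
   1$. *)
have : \sum_(k < J.+1) 2 / (n%:R * th k) <= 16 * e + 2 * (\sum_(k < J) s k).
  rewrite big_ord_recl; apply: lerD.
    by have := inv_th _ (leq0n J); move: lvl0; rewrite -/e /=; lra.
  rewrite mulr_sumr; apply: ler_sum => k _; rewrite /= /bump add1n.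
  have [_ _ _ dth] := lvl _ (ltn_ord k); have := inv_th _ (ltn_ord k).
  by lra.
have K14 : 0 <= 14 + 4 * K by lra.
by have := ler_wpM2l K14 sum_s; rewrite -/e; lra.
Qed.

End erm_bound.

(** * Combination of the two rates *)

Theorem mainTheorem7 (R : realType) (K1 r : R) :
  0 < K1 -> 0 < r -> r < 1 ->
  exists C1 : R,
    forall (d : measure_display) (X : measurableType d)
      (mu : probability X R) (S : set (X -> bool))
      (n : nat) (h : R) (shat : n.-tuple (X * bool)%type -> X -> bool),
    (forall t, S t -> classifier t) ->
    condition_M R S ->
    (forall eps : R, 0 < eps -> eps < 1 ->
       (bracketing_entropy eps S mu <= (K1 * eps `^ (- r))%:E)%E) ->
    (0 < n)%N ->
    0 <= h <= 1 ->
    empirical_risk_minimizer mu S shat ->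
    (ereal_sup [set expected_excess_risk Q.1 Q.2 shat
                 | Q in margin_model h S mu]
     <= C1%:E * Order.min (margin_rate n h r) (n%:R `^ (- 2^-1))%:E)%E.
Proof.
move=> K10 r0 r1; pose K := K1 + 1.
pose C := 20 + 16 * K + (14 + 4 * K) * (4 * (1 - chain_ratio r)^-1).
exists C => d X mu S n h shat Scl _ ent n0 /andP[h0 h1] [_ shatS erm].
apply: ge_ereal_sup => _ [[P eta] model <-].
have r01 : 0 < r < 1 by rewrite r0.
have m0 : 0 < n%:R :> R by rewrite ltr0n.
pose b : R := n%:R `^ (- 2^-1); have b0 : 0 < b by exact: powR_gt0.
have b1 : b <= 1.
  rewrite -(powRr0 n%:R); apply: ler_powR; first by rewrite ler1n.
  by rewrite oppr_le0 invr_ge0.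
pose g := Order.max h b.
have bg : b <= g by rewrite le_max lexx orbT.
have hg : h <= g by rewrite le_max lexx.
have g1 : g <= 1 by rewrite ge_max h1.
have g0 : 0 < g by exact: lt_le_trans bg.
have eb : rate n%:R r g <= b.
  by have := le_rate m0 r01 b0 bg; rewrite rate_invsqrt.
(* If $h \le b$ then $g = b$ is its own rate, so $gw \le b$ is paid by that term; otherwise $g =
   h$. *)
have gw w : 0 <= w <= 1 -> g * w <= h * w + rate n%:R r g.
  move=> /andP[w0 w1]; rewrite /g; case: (leP h b) => hb; last first.
    by rewrite lerDl ltW// rate_gt0// (lt_trans b0).
  rewrite rate_invsqrt// -/b; apply: (@le_trans _ _ b).
    by rewrite ler_piMr// ltW.
  by rewrite lerDr mulr_ge0.
have C0 : 0 <= C.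
  have q1 := chain_ratio_lt1 r1; have K0 : 0 < K by rewrite addr_gt0.
  have q2 : 0 <= (1 - chain_ratio r)^-1 by rewrite invr_ge0 subr_ge0 ltW.
  by rewrite /C addr_ge0 ?mulr_ge0//; lra.
have bgb : b <= g <= 1 by rewrite bg.
apply: le_trans
  (erm_expected_excess_risk K10 r01 n0 Scl ent model h0 bgb gw shatS erm) _.
rewrite -/C EFinM; apply: lee_pmul => //; rewrite ?lee_fin//.
  exact/ltW/rate_gt0.
(* The rate decreases in the margin and $h \le g$, which gives the margin rate when $h > 0$; at $h =
   0$ that rate is infinite. *)
rewrite le_min lee_fin eb andbT /margin_rate; case: eqP => [_|/eqP hn0].
  by rewrite leey.
by rewrite lee_fin; apply: le_rate; rewrite // lt_neqAle eq_sym hn0.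
Qed.
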